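(* Let $\{f(\cdot;\theta):\theta\in\Theta\}$ be a family of probability mass functions on $\mathbf{Z}_+=\{0,1,2,\ldots\}$ of the form $f(x;\theta)=f_0(x)\exp[b(\theta)x]\,h(\theta)$, each with support $\mathbf{Z}_+$ (so $f_0>0$ on $\mathbf{Z}_+$ and $h>0$). Let $\mu$ be a probability distribution on $\Theta$ and let $g(x)=\int f(x;t)\,d\mu(t)$ be the corresponding mixture pmf. Fix $\theta\in\Theta$ and let $X$ and $Y$ be random variables with pmfs $f(\cdot;\theta)$ and $g$ respectively. Then: 1. $X\leq_{st}Y$ if and only if $\int h(t)\,d\mu(t)\leq h(\theta)$; likewise, $X\leq_{hr}Y$ if and only if $\int h(t)\,d\mu(t)\leq h(\theta)$. 2. $X\leq_{lr}Y$ if and only if $$\exp[b(\theta)]\leq\frac{\int h(t)\exp[b(t)]\,d\mu(t)}{\int h(t)\,d\mu(t)};$$ likewise, $X\leq_{rh}Y$ if and only if the same inequality holds.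
   Context: $b$ and $h$ are real-valued measurable functions on the measurable parameter space $\Theta$. Let $X,Y$ have pmfs $f,g$ supported on $\mathbf{Z}_+$ and cumulative distribution functions $F,G$, and put $\bar F(x)=1-F(x)$, $\bar G(x)=1-G(x)$. Usual stochastic order: $X\leq_{st}Y$ if $\bar F(x)\leq\bar G(x)$ for all $x$. Hazard rate order: $X\leq_{hr}Y$ if $f(x)/\bar F(x)\geq g(x)/\bar G(x)$ for all $x\in\mathbf{Z}_+$. Reversed hazard rate order: $X\leq_{rh}Y$ if $f(x)/F(x)\leq g(x)/G(x)$ for all $x\in\mathbf{Z}_+$. Likelihood ratio order: $X\leq_{lr}Y$ if $f(x)/g(x)$ is a monotone decreasing (i.e. non-increasing) function on $\mathbf{Z}_+$. *)

(* Defs.v *)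
From HB Require Import structures.
From mathcomp Require Import all_boot all_order all_algebra.
From mathcomp Require Import all_classical all_reals all_analysis.

Set Implicit Arguments.
Unset Strict Implicit.
Unset Printing Implicit Defensive.

Import Order.TTheory GRing.Theory Num.Theory.
Import numFieldNormedType.Exports.

Local Open Scope classical_set_scope.
Local Open Scope ring_scope.

Definition is_pmf (R : realType) (p : nat -> R) : Prop :=
  (forall x, 0 <= p x) /\ (\sum_(0 <= x <oo) (p x)%:E = 1)%E.

(* Z_+-valued random variables are real random variables whose law is carried
   by the image of nat in R, so that pmf and cdf apply. *)
Definition has_pmf d (T : measurableType d) (R : realType)
    (P : probability T R) (X : {RV P >-> R}) (p : nat -> R) : Prop :=
  distribution P X (range (fun n : nat => n%:R : R)) = 1%E /\
  forall n : nat, pmf X n%:R = p n.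

Definition rcdf d (T : measurableType d) (R : realType)
    (P : probability T R) (X : {RV P >-> R}) (x : R) : R := fine (cdf X x).

Definition survival d (T : measurableType d) (R : realType)
    (P : probability T R) (X : {RV P >-> R}) (x : R) : R := 1 - rcdf X x.

(* The hr, rh and lr orders are meant for variables whose pmfs are positive on
   all of nat: the denominators below are then positive. *)
Section StochasticOrders.
Context d d' (T : measurableType d) (T' : measurableType d') (R : realType).
Context (P : probability T R) (Q : probability T' R).
Variables (X : {RV P >-> R}) (Y : {RV Q >-> R}).

Definition st_le : Prop := forall x : R, survival X x <= survival Y x.

Definition hr_le : Prop := forall x : nat,
  pmf X x%:R / survival X x%:R >= pmf Y x%:R / survival Y x%:R.

Definition rh_le : Prop := forall x : nat,
  pmf X x%:R / rcdf X x%:R <= pmf Y x%:R / rcdf Y x%:R.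

Definition lr_le : Prop :=
  nonincreasing_seq (fun x : nat => pmf X x%:R / pmf Y x%:R).

End StochasticOrders.

Definition expfam (R : realType) (Theta : Type) (f0 : nat -> R)
    (b h : Theta -> R) (t : Theta) (x : nat) : R :=
  f0 x * expR (b t * x%:R) * h t.

Definition mixture d (Theta : measurableType d) (R : realType)
    (mu : probability Theta R) (f : Theta -> nat -> R) (x : nat) : R :=
  \int[mu]_t f t x.

(* Main.v *)
Require Import Defs.
From HB Require Import structures.
From mathcomp Require Import all_boot all_order all_algebra.
From mathcomp Require Import all_classical all_reals all_analysis.
From mathcomp Require Import measurable_realfun ring lra.

Set Implicit Arguments.
Unset Strict Implicit.
Unset Printing Implicit Defensive.

Import Order.TTheory GRing.Theory Num.Theory.
Import numFieldNormedType.Exports.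

Local Open Scope classical_set_scope.
Local Open Scope ring_scope.

(** Write $p(x) = f(x;\theta)$ for the pmf of $X$, $q$ for the mixture pmf of
$Y$ and $l = q/p$.  Up to the positive factor $1/h(\theta)$,
$l(x)$ is the integral of $h(t) (e^{b(t)} / e^{b(\theta)})^x$ against $\mu$,
an average of powers $u^x$ with $u > 0$.  Hence $l$ is positive and convex in
$x$, because the second difference $u^x (u - 1)^2$ of each power is nonnegative
([convex_mixture_ratio]).  The two integral conditions of the theorem are
statements on the first two values of $l$: the first is $l(0) \leq 1$
([mixture_ratio0_le1]), the second is $l(0) \leq l(1)$
([mixture_ratio0_le_ratio1]).

A convex sequence never decreases again after a step up or a level step.  So
$l(0) \leq l(1)$ makes $l$ nondecreasing, which is the likelihood ratio order;
that order implies the reversed hazard rate order, and the latter at $x = 1$ is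
again $l(0) \leq l(1)$ ([rh_of_lr], [ratio01_of_rh]).

For the other two orders the circle is
$l(0) \leq 1 \Rightarrow$ hr $\Rightarrow$ st $\Rightarrow l(0) \leq 1$.  The
last arrow is the inequality of survival functions at $0$, and the second holds
for all positive pmfs ([st_of_hr]).  In the first one ([hr_of_le1]), the hazard
inequality at $x$ compares the $q$-mass beyond $x$ with $l(x)$ times the
$p$-mass beyond $x$.  Either $l$ is nondecreasing from $x$ on, and the comparison holds
term by term; or $l$ is still decreasing at $x$, so $l \leq l(0) \leq 1$ up to
$x$, and then $q$ has at most the mass of $p$ up to $x$, hence at least as much
beyond; the weight $l(x) \leq 1$ only helps. *)

(** * Convex sequences *)

Definition convex_seq (R : realType) (l : nat -> R) : Prop :=
  forall x, l x.+1 + l x.+1 <= l x + l x.+2.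

Lemma convex_seq_nondecreasing_from (R : realType) (l : nat -> R) (x : nat) :
  convex_seq l -> l x <= l x.+1 ->
  forall i j, (x <= i <= j)%N -> l i <= l j.
Proof.
move=> cvx lx; have step k : l (x + k)%N <= l (x + k.+1)%N.
  elim: k => [|k IHk]; first by rewrite addn0 addn1.
  by have := cvx (x + k)%N; rewrite !addnS in IHk *; lra.
move=> i j /andP[xi ij]; have /nondecreasing_seqP mono := step.
have := mono (i - x)%N (j - x)%N (leq_sub2r x ij).
by rewrite !subnKC// (leq_trans xi).
Qed.

(** If the sequence is still strictly decreasing at [x], no earlier step can have
been an increase. *)
Lemma convex_seq_le0 (R : realType) (l : nat -> R) (x : nat) :
  convex_seq l -> l x.+1 < l x -> forall i, (i <= x)%N -> l i <= l 0%N.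
Proof.
move=> cvx lx; elim=> [//|i IHi] ix.
apply: le_trans (IHi (ltnW ix)); rewrite leNgt; apply/negP => /ltW li.
have := convex_seq_nondecreasing_from cvx li (i := x) (j := x.+1).
by rewrite (ltnW ix) leqnSn => /(_ isT); rewrite leNgt lx.
Qed.

(** * Orders between a pmf and its product with a convex density *)

Section density_orders.
Context (R : realType) (p l : nat -> R).
Let q x := p x * l x.
Hypotheses (p_gt0 : forall x, 0 < p x) (l_gt0 : forall x, 0 < l x).
Hypotheses (p1 : series p @ \oo --> (1 : R)) (q1 : series q @ \oo --> (1 : R)).

Lemma partial_sum_lt1 (u : nat -> R) n :
  (forall x, 0 < u x) -> series u @ \oo --> (1 : R) -> series u n < 1.
Proof.
move=> u0 u1; apply: (@lt_le_trans _ _ (series u n.+1)).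
  by rewrite seriesSr ltrDl.
have <- := cvg_lim _ u1 => //; apply: nondecreasing_cvgn_le.
  by apply/nondecreasing_seqP => k; rewrite seriesSr lerDl ltW.
by apply/cvg_ex; exists 1.
Qed.

(** Beyond [x] the comparison is between infinite tails; total mass 1 on both
sides turns them into complements of partial sums. *)
Lemma hr_of_le1 : convex_seq l -> l 0%N <= 1 ->
  forall x, q x * (1 - series p x.+1) <= p x * (1 - series q x.+1).
Proof.
move=> cvx l0 x; rewrite /q -mulrA ler_pM2l//.
have [lx|lx] := leP (l x) (l x.+1).
  have up := convex_seq_nondecreasing_from cvx lx.
  have cp : (l x * (series p n - series p x.+1)) @[n --> \oo] -->
      l x * (1 - series p x.+1).
    by apply: cvgMr; apply: cvgB => //; apply: cvg_cst.
  have cq : (series q n - series q x.+1) @[n --> \oo] -->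
      (1 - series q x.+1).
    by apply: cvgB => //; apply: cvg_cst.
  apply: (ler_cvg_to cp cq); near=> n.
  have xn : (x.+1 <= n)%N by near: n; exact: nbhs_infty_ge.
  rewrite !sub_series_geq// mulr_sumr big_nat [leRHS]big_nat.
  apply: ler_sum => k /andP[xk _].
  by rewrite mulrC ler_pM2l// up// leqnn ltnW.
(* Here l <= 1 up to x, so the q-tail beats the p-tail even unweighted. *)
have down := convex_seq_le0 cvx lx.
have qp : series q x.+1 <= series p x.+1.
  rewrite /series/= big_nat [leRHS]big_nat ler_sum// => k /andP[_ kx].
  by rewrite ger_pMr// (le_trans (down _ _)).
have := partial_sum_lt1 x.+1 p_gt0 p1.
have := down x (leqnn x); have := l_gt0 x; nra.
Unshelve. all: end_near. Qed.

(** The hazard inequality says that the ratio of the $q$-tail to the $p$-tail is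
nondecreasing, and this ratio starts at 1. *)
Lemma st_of_hr :
  (forall x, q x * (1 - series p x.+1) <= p x * (1 - series q x.+1)) ->
  forall n, series q n <= series p n.
Proof.
move=> hr; elim=> [|n IHn]; first by rewrite /series/= !big_geq.
have := hr n; have := partial_sum_lt1 n p_gt0 p1.
have := partial_sum_lt1 n.+1 p_gt0 p1.
rewrite !seriesSr; have := p_gt0 n.
(* With A = 1 - a <= B = 1 - b the hypothesis reads v A <= u B, whence
   A (B - v) >= B (A - u) >= A (A - u), and A > 0 cancels. *)
move: (series p n) (series q n) IHn (p n) (q n) => a b ba u v u0 au a1 h.
nra.
Qed.

Lemma le1_of_st : series q 1%N <= series p 1%N -> l 0%N <= 1.
Proof. by rewrite /series/= !big_nat1 /q ger_pMr. Qed.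

Lemma rh_of_lr : (forall i j, (i <= j)%N -> l i <= l j) ->
  forall x, p x * series q x.+1 <= q x * series p x.+1.
Proof.
move=> inc x; rewrite /q -mulrA ler_pM2l// /series/= mulr_sumr.
rewrite big_nat [leRHS]big_nat ler_sum// => k /andP[_ kx].
by rewrite mulrC ler_pM2r// inc.
Qed.

Lemma ratio01_of_rh :
  p 1%N * series q 2%N <= q 1%N * series p 2%N -> l 0%N <= l 1%N.
Proof.
rewrite /series/= !big_nat_recr//= !big_geq// !add0r /q.
have := p_gt0 0%N; have := p_gt0 1%N.
move=> p10 p00; rewrite !mulrDr.
have -> : p 1%N * (p 1%N * l 1%N) = p 1%N * l 1%N * p 1%N by ring.
rewrite lerD2r.
have -> : p 1%N * (p 0%N * l 0%N) = (p 1%N * p 0%N) * l 0%N by ring.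
have -> : p 1%N * l 1%N * p 0%N = (p 1%N * p 0%N) * l 1%N by ring.
by rewrite ler_pM2l// mulr_gt0.
Qed.
End density_orders.

(** * Random variables with values in nat *)

Lemma probability_setI_full d (T : measurableType d) (R : realType)
    (P : probability T R) (A Z : set T) :
  measurable A -> measurable Z -> P Z = 1%E -> P A = P (A `&` Z).
Proof.
move=> mA mZ PZ; have -> : P A = (P (A `\` Z) + P (A `&` Z))%E by exact: measureDI.
suff -> : P (A `\` Z) = 0%E by rewrite add0e.
apply/eqP; rewrite eq_le measure_ge0 andbT.
rewrite -[leRHS](_ : P (~` Z) = 0%E); last by rewrite probability_setC// PZ subee.
apply: le_measure; rewrite ?inE; [exact: measurableD|exact: measurableC|].
by move=> x [].
Qed.

Section nat_valued.
Context d (T : measurableType d) (R : realType) (P : probability T R).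
Context (X : {RV P >-> R}) (p : nat -> R).
Hypothesis X_p : has_pmf X p.

(** The threshold [r] is an arbitrary real, as the usual stochastic order
quantifies over all of them; only the number [N] of naturals below [r] matters. *)
Lemma rcdf_partial_sum (r : R) (N : nat) :
  (forall k : nat, (k%:R <= r) = (k < N)%N) -> rcdf X r = series p N.
Proof.
move=> rN; have [Xnat Xp] := X_p; rewrite /rcdf /cdf.
set Z := range _ in Xnat.
have mZ : measurable Z by apply: countable_measurable => //; exact: card_image_le.
have mI : measurable `]-oo, r] by exact: measurable_itv.
have -> : distribution P X `]-oo, r] = distribution P X (`]-oo, r] `&` Z).
  exact: probability_setI_full.
have -> : `]-oo, r] `&` Z = \big[setU/set0]_(i < N) [set (i%:R : R)].
  rewrite -(bigcup_mkord N (fun i : nat => [set (i%:R : R)])).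
  apply/seteqP; split=> [x /= [+ [k _ kx]]|x [k kN /= ->]].
    by rewrite -kx in_itv/= => kr; exists k => //=; rewrite -rN.
  split; last by exists k.
  by move: kN; rewrite /= in_itv/= -rN.
have -> : distribution P X (\big[setU/set0]_(i < N) [set (i%:R : R)]) =
    (\sum_(i < N) distribution P X [set (i%:R : R)])%E.
  have tI : trivIset [set: nat] (fun i : nat => [set (i%:R : R)]).
    by move=> i j _ _ [x [/= -> /eqP]]; rewrite eqr_nat => /eqP.
  by rewrite (measure_bigsetU (distribution P X) _ tI).
rewrite /series/= big_mkord -sum_fine; last by move=> i _; exact: fin_num_measure.
by apply: eq_bigr => i _; rewrite -Xp.
Qed.

Lemma rcdf_nat (n : nat) : rcdf X n%:R = series p n.+1.
Proof. by apply: rcdf_partial_sum => k; rewrite ler_nat. Qed.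

(** This gives total mass 1 for the mixture too, without exchanging sum and
integral. *)
Lemma series_pmf_cvg1 : series p @ \oo --> (1 : R).
Proof.
have /fine_cvgP[_ c1] := cvg_cdfy1 X.
rewrite -(cvg_shiftS (series p)).
have <- : (fun n : nat => rcdf X n%:R) = (fun n => series p n.+1).
  by apply/funext => n; rewrite rcdf_nat.
have nat_infty : (n%:R : R) @[n --> \oo] --> +oo by exact/cvgryPge/nbhs_infty_ger.
exact: (cvg_comp _ _ nat_infty c1).
Qed.
End nat_valued.

(** * Moments of the mixing distribution and the density of the mixture *)

Lemma pmf_le1 (R : realType) (p : nat -> R) x : is_pmf p -> p x <= 1.
Proof.
move=> [p0 p1]; rewrite -lee_fin -p1.
apply: le_trans (nneseries_lim_ge x.+1 _); last by move=> n _ _; rewrite lee_fin.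
by rewrite sumEFin lee_fin big_nat_recr//= lerDr sumr_ge0.
Qed.

Lemma Rintegral_gt0 d (T : measurableType d) (R : realType)
    (mu : probability T R) (f : T -> R) :
  mu.-integrable [set: T] (EFin \o f) -> (forall t, 0 < f t) ->
  0 < \int[mu]_t f t.
Proof.
move=> fint f0; rewrite lt_neqAle Rintegral_ge0 ?andbT; last by move=> t _; exact: ltW.
apply/eqP => /esym /eqP I0.
have : (\int[mu]_(t in setT) `|(EFin \o f) t| = 0)%E.
  under eq_integral do rewrite /= ger0_norm ?ltW//.
  apply/eqP; rewrite -(@fineK _ (\int[mu]_t _)%E); last exact: integrable_fin_num.
  by rewrite eqe.
have mf := measurable_int _ fint.
move/(ae_eq_integral_abs mu measurableT mf) => [A [mA A0 subA]].
have AT : A = setT.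
  by apply/seteqP; split=> // t _; apply: subA => /(_ I)[] /eqP; rewrite gt_eqF.
have A1 : mu A = 1%E by rewrite AT probability_setT.
by have /eqP := etrans (esym A1) A0; rewrite onee_eq0.
Qed.

Section moments.
Context d (Theta : measurableType d) (R : realType) (mu : probability Theta R).
Context (f0 : nat -> R) (b h : Theta -> R).
Hypotheses (mb : measurable_fun [set: Theta] b).
Hypotheses (mh : measurable_fun [set: Theta] h).
Hypotheses (f0_gt0 : forall x, 0 < f0 x) (h_gt0 : forall t, 0 < h t).
Hypothesis f_pmf : forall t, is_pmf (expfam f0 b h t).

Lemma expfamE t x : expfam f0 b h t x = f0 x * (h t * expR (b t) ^+ x).
Proof. by rewrite /expfam expRM_natr; ring. Qed.

Definition moment x : R := \int[mu]_t (h t * expR (b t) ^+ x).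

(** The integrand is $f(x;t)/f_0(x)$, bounded by $1/f_0(x)$ as a pmf is at most
1. *)
Lemma integrable_moment x :
  mu.-integrable [set: Theta] (EFin \o (fun t => h t * expR (b t) ^+ x)).
Proof.
apply: measurable_bounded_integrable => //.
- by rewrite -ge0_fin_numE// fin_num_measure.
- apply: measurable_funM => //; apply: measurable_funX.
  exact: measurableT_comp.
exists (f0 x)^-1; split; first by rewrite num_real.
move=> M /ltW Mx t _ /=; apply: le_trans Mx.
rewrite ger0_norm; last by rewrite mulr_ge0 ?exprn_ge0 ?expR_ge0 ?ltW.
by rewrite -[leRHS]mulr1 -ler_pdivrMl ?invrK ?invr_gt0// -expfamE pmf_le1.
Qed.

Lemma moment_gt0 x : 0 < moment x.
Proof.
apply: Rintegral_gt0 (integrable_moment x) _ => t.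
by rewrite mulr_gt0 ?exprn_gt0 ?expR_gt0.
Qed.

Lemma mixtureE x : mixture mu (expfam f0 b h) x = f0 x * moment x.
Proof.
rewrite /mixture -RintegralZl//; last exact: integrable_moment.
by apply: eq_Rintegral => t _; rewrite expfamE.
Qed.

(** The left-hand side integrates $h e^{bx} (e^b - c)^2$. *)
Lemma moment_second_diff (c : R) x :
  0 <= moment x.+2 - 2 * c * moment x.+1 + c ^+ 2 * moment x.
Proof.
have int0 := integrable_moment.
have intZ k y : mu.-integrable [set: Theta] (EFin \o (fun t => k * (h t * expR (b t) ^+ y))).
  by have := integrableZl measurableT k (int0 y); apply: eq_integrable.
rewrite /moment -!RintegralZl// -RintegralB// -RintegralD//; last first.
  exact: (integrableB measurableT (int0 x.+2) (intZ _ _)).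
apply: Rintegral_ge0 => t _; rewrite !exprS.
rewrite [leRHS](_ : _ = h t * expR (b t) ^+ x * (expR (b t) - c) ^+ 2).
  by rewrite mulr_ge0 ?sqr_ge0 ?mulr_ge0 ?exprn_ge0 ?expR_ge0 ?ltW.
by rewrite /=; ring.
Qed.

Definition mixture_ratio theta x : R := moment x / (expR (b theta) ^+ x * h theta).

Lemma mixture_ratio_gt0 theta x : 0 < mixture_ratio theta x.
Proof. by rewrite divr_gt0 ?moment_gt0 ?mulr_gt0 ?exprn_gt0 ?expR_gt0. Qed.

Lemma mixture_ratioE theta x :
  mixture mu (expfam f0 b h) x = expfam f0 b h theta x * mixture_ratio theta x.
Proof.
rewrite mixtureE expfamE /mixture_ratio; field.
by rewrite !gt_eqF ?exprn_gt0 ?expR_gt0.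
Qed.

(** Up to a positive factor the second difference of the ratio is the expression
of [moment_second_diff] at $c = e^{b(\theta)}$. *)
Lemma convex_mixture_ratio theta : convex_seq (mixture_ratio theta).
Proof.
move=> x; rewrite /mixture_ratio; set c := expR (b theta).
have c0 : 0 < c by exact: expR_gt0.
rewrite -subr_ge0.
have -> : moment x / (c ^+ x * h theta) + moment x.+2 / (c ^+ x.+2 * h theta) -
  (moment x.+1 / (c ^+ x.+1 * h theta) + moment x.+1 / (c ^+ x.+1 * h theta)) =
  (moment x.+2 - 2 * c * moment x.+1 + c ^+ 2 * moment x) / (c ^+ x.+2 * h theta).
  by rewrite !exprS; field; rewrite !gt_eqF ?exprn_gt0.
by rewrite divr_ge0 ?moment_second_diff// mulr_ge0 ?exprn_ge0 ?ltW.
Qed.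

Lemma mixture_ratio0_le1 theta :
  (mixture_ratio theta 0 <= 1) = (\int[mu]_t h t <= h theta).
Proof.
rewrite /mixture_ratio expr0 mul1r ler_pdivrMr// mul1r.
by congr (_ <= _); apply: eq_Rintegral => t _; rewrite expr0 mulr1.
Qed.

Lemma mixture_ratio0_le_ratio1 theta :
  (mixture_ratio theta 0 <= mixture_ratio theta 1) =
  (expR (b theta) <= (\int[mu]_t (h t * expR (b t))) / \int[mu]_t h t).
Proof.
have -> : \int[mu]_t h t = moment 0.
  by apply: eq_Rintegral => t _; rewrite expr0 mulr1.
have -> : \int[mu]_t (h t * expR (b t)) = moment 1.
  by apply: eq_Rintegral => t _; rewrite expr1.
rewrite /mixture_ratio expr0 expr1 mul1r [RHS]ler_pdivlMr ?moment_gt0//.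
rewrite [LHS]ler_pdivlMr ?mulr_gt0 ?expR_gt0//.
by congr (_ <= _); field; rewrite gt_eqF.
Qed.
End moments.

(** * Characterization of the four orders *)

Theorem mainTheorem6 (R : realType)
    (d : measure_display) (Theta : measurableType d)
    (f0 : nat -> R) (b h : Theta -> R)
    (mb : measurable_fun [set: Theta] b) (mh : measurable_fun [set: Theta] h)
    (f0_gt0 : forall x : nat, 0 < f0 x) (h_gt0 : forall t : Theta, 0 < h t)
    (f_pmf : forall t : Theta, is_pmf (expfam f0 b h t))
    (mu : probability Theta R) (theta : Theta)
    (d1 : measure_display) (T1 : measurableType d1) (P1 : probability T1 R)
    (X : {RV P1 >-> R})
    (d2 : measure_display) (T2 : measurableType d2) (P2 : probability T2 R)
    (Y : {RV P2 >-> R})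
    (X_pmf : has_pmf X (expfam f0 b h theta))
    (Y_pmf : has_pmf Y (mixture mu (expfam f0 b h))) :
  ((st_le X Y <-> \int[mu]_t h t <= h theta) /\
   (hr_le X Y <-> \int[mu]_t h t <= h theta)) /\
  ((lr_le X Y <->
      expR (b theta) <= (\int[mu]_t (h t * expR (b t))) / \int[mu]_t h t) /\
   (rh_le X Y <->
      expR (b theta) <= (\int[mu]_t (h t * expR (b t))) / \int[mu]_t h t)).
Proof.
rewrite -(mixture_ratio0_le1 mu b) // -(mixture_ratio0_le_ratio1 mu mb mh f0_gt0)//.
have cvx := convex_mixture_ratio mu mb mh f0_gt0 h_gt0 f_pmf theta.
have l0 := mixture_ratio_gt0 mu mb mh f0_gt0 h_gt0 f_pmf theta.
have qE : mixture mu (expfam f0 b h) =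
    fun x => expfam f0 b h theta x * mixture_ratio mu b h theta x.
  by apply/funext => x; apply: mixture_ratioE.
rewrite {}qE in Y_pmf.
have p0 x : 0 < expfam f0 b h theta x.
  by rewrite expfamE !mulr_gt0// exprn_gt0 ?expR_gt0.
(* From here on only positivity and convexity of the density matter. *)
move: (expfam f0 b h theta) (mixture_ratio mu b h theta)
  p0 X_pmf l0 cvx Y_pmf => p l p0 Xp l0 cvx Yq.
set q := fun x => p x * l x in Yq.
have q0 x : 0 < q x by rewrite mulr_gt0.
have p1 := series_pmf_cvg1 Xp; have q1 := series_pmf_cvg1 Yq.
have [_ pX] := Xp; have [_ qY] := Yq.
have Sgt0 u n : (forall x, 0 < u x) -> 0 < series u n.+1 :> R.
  by move=> u0; rewrite seriesSr ltr_wpDl// sumr_ge0// => i _; exact: ltW.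
have hrE : hr_le X Y <->
    forall x, q x * (1 - series p x.+1) <= p x * (1 - series q x.+1).
  have E x : (pmf Y x%:R / survival Y x%:R <= pmf X x%:R / survival X x%:R) =
      (q x * (1 - series p x.+1) <= p x * (1 - series q x.+1)).
    rewrite /survival (rcdf_nat Xp) (rcdf_nat Yq) pX qY.
    rewrite ler_pdivrMr ?subr_gt0 ?partial_sum_lt1// [leRHS]mulrAC.
    by rewrite ler_pdivlMr ?subr_gt0 ?partial_sum_lt1.
  by split=> hr x; have := hr x; rewrite ?E//; move=> ?; rewrite E.
have rhE : rh_le X Y <->
    forall x, p x * series q x.+1 <= q x * series p x.+1.
  have E x : (pmf X x%:R / rcdf X x%:R <= pmf Y x%:R / rcdf Y x%:R) =
      (p x * series q x.+1 <= q x * series p x.+1).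
    rewrite (rcdf_nat Xp) (rcdf_nat Yq) pX qY.
    by rewrite ler_pdivrMr ?Sgt0// [leRHS]mulrAC ler_pdivlMr ?Sgt0.
  by split=> rh x; have := rh x; rewrite ?E//; move=> ?; rewrite E.
have lrE : lr_le X Y <-> nondecreasing_seq l.
  have ratio x : pmf X x%:R / pmf Y x%:R = (l x)^-1.
    by rewrite pX qY /q; field; rewrite !gt_eqF.
  split=> mono i j ij; last by rewrite !ratio lef_pV2// ?posrE// mono.
  by have := mono i j ij; rewrite !ratio lef_pV2// posrE.
have st_of n : st_le X Y -> series q n.+1 <= series p n.+1.
  by move=> /(_ n%:R); rewrite /survival (rcdf_nat Xp) (rcdf_nat Yq) lerD2l lerN2.
have to_st : (forall n, series q n <= series p n) -> st_le X Y.
  move=> qp r; have [N rN] : exists N, forall k : nat, (k%:R <= r) = (k < N)%N.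
    have [r0|r0] := ltP r 0.
      by exists 0%N => k; rewrite leNgt (lt_le_trans r0).
    by exists (Num.trunc r).+1 => k; rewrite ltnS truncn_ge_nat.
  by rewrite /survival (rcdf_partial_sum Xp rN) (rcdf_partial_sum Yq rN) lerD2l lerN2.
have st_le1 : st_le X Y -> l 0%N <= 1 by move/(st_of 0%N); exact: le1_of_st.
have hr_st : hr_le X Y -> st_le X Y by move/hrE/st_of_hr => hr; exact/to_st/hr.
have le1_hr : l 0%N <= 1 -> hr_le X Y by move=> l01; apply/hrE/hr_of_le1.
have lr_of_01 : l 0%N <= l 1%N -> lr_le X Y.
  move=> l01; apply/lrE => i j ij.
  by apply: (convex_seq_nondecreasing_from cvx l01); rewrite ij.
have lr_rh : lr_le X Y -> rh_le X Y by move/lrE => inc; apply/rhE/rh_of_lr.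
have rh_01 : rh_le X Y -> l 0%N <= l 1%N by move/rhE/(_ 1%N); exact: ratio01_of_rh.
by split; split; split; auto.
Qed.
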